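(* For each Fishburn cover $P$ there is a unique Fishburn tree $T$ such that $\mathfrak{P}(T)=P$.
   Context: Write $[k]=\{1,\dots,k\}$. A binary tree is either empty or a triple $T=(L,r,R)$ with $r$ a node (the root) and $L,R$ binary trees (left and right subtree). $V(T)$ is the set of nodes and the size of $T$ is $|V(T)|$. A vertex labeling is a map $\mathfrak{l}:V(T)\to\{1,2,\dots\}$; $\max(T)$ is the largest label, with $\max(\emptyset)=0$. Labeled binary trees are considered up to label-preserving isomorphism of binary trees. $T$ is decreasing if it is empty, or $T=(L,r,R)$ with $L,R$ decreasing and $\mathfrak{l}(r)\ge\max\{\max(L),\max(R)\}$. $T$ is strictly decreasing to the left if it is empty, or $T=(L,r,R)$ with $\mathfrak{l}(r)>\max(L)$ and $L,R$ strictly decreasing to the left. An endotree of size $n$ is a decreasing binary tree of size $n$ that is strictly decreasing to the left and has all labels in $[n]$; it is regular if the set of its labels equals $[k]$ for some $k\le n$. The in-order traversal of $T=(L,r,R)$ traverses $L$ recursively, then visits $r$, then traverses $R$ recursively; $v_i$ is the $i$-th visited node. Put $\mathrm{asctops}(T)=\{v_1\}\cup\{v_i: v_i\text{ has a left child}\}$ and $\mathrm{nub}(T)=\{v_j:\mathfrak{l}(v_i)\ne\mathfrak{l}(v_j)\text{ for each }i<j\}$ (both empty for the empty tree). A Fishburn tree is a regular endotree $T$ with $\mathrm{nub}(T)=\mathrm{asctops}(T)$. A maximal right path is a nonempty sequence of nodes $(w_1,\dots,w_m)$ with $w_{i+1}$ the right child of $w_i$, where $w_1$ is not a right child of any node and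 $w_m$ has no right child; maximal left paths are defined analogously. $\mathrm{rpath}(v)$ and $\mathrm{lpath}(v)$ are the unique maximal right and left paths containing $v$. For nonempty $T$ with root $r$, $\mathrm{diag}(T)=\mathrm{lpath}(r)$ (viewed as a set; it is contained in $\mathrm{asctops}(T)$) and $\overline{\mathrm{diag}}(T)=\mathrm{asctops}(T)\setminus\mathrm{diag}(T)$. For a Fishburn tree $T$ with $k=\max(T)$, the set $\mathrm{asctops}(T)$ has exactly one node of each label $i\in[k]$. If $v\in\mathrm{asctops}(T)$ has label $i$, let $W_i=\mathrm{rpath}(v)$ if $v\in\mathrm{diag}(T)$, and $W_i=\mathrm{rpath}(\mathrm{lchild}(v))$ if $v\in\overline{\mathrm{diag}}(T)$, where $\mathrm{lchild}(v)$ is the left child of $v$; $W_1,\dots,W_k$ are exactly the maximal right paths of $T$. Let $B_i$ be the multiset $\{\mathfrak{l}(u):u\in W_i\}$ (labels counted with multiplicity) and $\mathfrak{P}(T)=B_1\dots B_k$. A Fishburn cover is an ordered list $P=B_1\dots B_k$ of $k$ nonempty multisets of positive integers such that the set of integers occurring in $B_1,\dots,B_k$ is exactly $[k]$, and for all $i\in[k]$, if $j\in B_i$ then $j\le i$. (For $k=0$, the empty list corresponds to the empty tree.) *)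

(* Defs.v *)
From mathcomp Require Import all_boot.
From mathcomp Require Export finmap multiset.

Set Implicit Arguments.
Unset Strict Implicit.
Unset Printing Implicit Defensive.

(* A vertex-labeled binary tree up to label-preserving isomorphism.  The label
   0 is only excluded by [endotree], which forces the labels into [n]. *)
Inductive tree := Empty | Node of tree & nat & tree.

(* A node is addressed by the directions (false = left, true = right) leading
   to it from the root [::]; [rcons v b] is the child of v in direction b. *)
Definition position := seq bool.

Definition lchild (v : position) : position := rcons v false.
Definition rchild (v : position) : position := rcons v true.

(* The nodes of T, each listed once, in the order of the in-order traversal. *)
Fixpoint inorder (T : tree) : seq position :=
  if T is Node L _ R then
    map (cons false) (inorder L) ++ [::] :: map (cons true) (inorder R)
  else [::].

Fixpoint subtree (T : tree) (v : position) : tree :=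
  match v, T with
  | [::], _ => T
  | b :: v', Node L _ R => subtree (if b then R else L) v'
  | _ :: _, Empty => Empty
  end.

Definition label (T : tree) (v : position) : nat :=
  if subtree T v is Node _ a _ then a else 0.

Definition tree_size (T : tree) : nat := size (inorder T).

Definition labels (T : tree) : seq nat := map (label T) (inorder T).

Fixpoint max_label (T : tree) : nat :=
  if T is Node L a R then maxn a (maxn (max_label L) (max_label R)) else 0.

Fixpoint decreasing (T : tree) : bool :=
  if T is Node L a R then
    [&& decreasing L, decreasing R & maxn (max_label L) (max_label R) <= a]
  else true.

Fixpoint strictly_decreasing_left (T : tree) : bool :=
  if T is Node L a R then
    [&& max_label L < a, strictly_decreasing_left L
      & strictly_decreasing_left R]
  else true.

Definition endotree (T : tree) : bool :=
  [&& decreasing T, strictly_decreasing_left T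
    & all (fun a => 0 < a <= tree_size T) (labels T)].

Definition regular_endotree (T : tree) : Prop :=
  endotree T /\
  exists2 k, k <= tree_size T & forall a, (a \in labels T) = (0 < a <= k).

Definition asctops (T : tree) : seq position :=
  [seq v <- inorder T
     | (index v (inorder T) == 0) || (lchild v \in inorder T)].

Definition nub (T : tree) : seq position :=
  [seq v <- inorder T
     | all (fun u => label T u != label T v)
           (take (index v (inorder T)) (inorder T))].

Definition fishburn_tree (T : tree) : Prop :=
  regular_endotree T /\ nub T =i asctops T.

(* The maximal right (b = true) and left (b = false) paths. *)
Definition maximal_path (b : bool) (T : tree) (s : seq position) : bool :=
  if s is w :: s' then
    [&& all [in inorder T] s,
        path (fun u v => v == rcons u b) w s',
        all (fun u => rcons u b != w) (inorder T)
      & rcons (last w s') b \notin inorder T]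
  else false.

(* The first node of the maximal path in direction b through v, obtained by
   removing the longest suffix of v consisting of b's only. *)
Fixpoint path_top (b : bool) (v : position) : position :=
  if v is x :: v' then
    if all (pred1 b) v then [::] else x :: path_top b v'
  else [::].

Fixpoint spine (b : bool) (T : tree) : seq position :=
  if T is Node L _ R then
    [::] :: map (cons b) (if b then spine b R else spine b L)
  else [::].

(* The unique maximal path in direction b containing the node v of T: see
   [maximal_dirpath], [mem_dirpath] and [dirpath_unique] below. *)
Definition dirpath (b : bool) (T : tree) (v : position) : seq position :=
  let w := path_top b v in map (cat w) (spine b (subtree T w)).

Definition rpath := dirpath true.
Definition lpath := dirpath false.

Definition diag (T : tree) : seq position := lpath T [::].

(* In a Fishburn tree there is exactly one node of asctops T of each label
   i in [k], k = max_label T, so the choice of the first one is immaterial. *)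
Definition asctop_of (T : tree) (i : nat) : position :=
  head [::] [seq v <- asctops T | label T v == i].

Definition wpath (T : tree) (i : nat) : seq position :=
  let v := asctop_of T i in
  if v \in diag T then rpath T v else rpath T (lchild v).

Definition block (T : tree) (i : nat) : {mset nat}%mset :=
  seq_mset (map (label T) (wpath T i)).

Definition cover_of (T : tree) : seq {mset nat}%mset :=
  map (block T) (iota 1 (max_label T)).

(* Lists are indexed from 0: the i-th block B_i of P is nth mset0 P i.-1.  The
   second condition also forces all the integers occurring to be positive. *)
Definition fishburn_cover (P : seq {mset nat}%mset) : Prop :=
  [/\ forall B : {mset nat}%mset, B \in P -> B != mset0,
      forall a, (exists2 B : {mset nat}%mset, B \in P & a \in B) <->
                0 < a <= size P
    & forall i j, 0 < i <= size P -> j \in nth mset0 P i.-1 -> j <= i].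

Lemma nseqD1r (n : nat) (b : bool) : nseq (n + 1) b = nseq n b ++ [:: b].
Proof. exact: nseqD. Qed.

Lemma iota1S m : iota 1 m.+1 = iota 1 m ++ [:: m.+1].
Proof. by rewrite -[m.+1]addn1 iotaD addnC. Qed.

Lemma subtree_cat T u v : subtree T (u ++ v) = subtree (subtree T u) v.
Proof.
elim: u T => [|b u IHu] [|L a R] //; try exact: IHu.
by move: v {IHu} => [].
Qed.

Lemma mem_inorder T v :
  (v \in inorder T) = (if subtree T v is Node _ _ _ then true else false).
Proof.
have inj (b : bool) : injective (cons b) by move=> x y [].
have no (b c : bool) s x : b != c -> (b :: x \in map (cons c) s) = false.
  by move=> bc; apply/mapP => -[y _ [E _]]; rewrite E eqxx in bc.
elim: T v => [|L IHL a R IHR] [|b v] //=; rewrite mem_cat in_cons ?eqxx ?orbT //.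
by case: b; rewrite mem_map // no // ?IHR ?IHL ?orbF.
Qed.

Lemma uniq_inorder T : uniq (inorder T).
Proof.
have inj (b : bool) : injective (cons b) by move=> x y [].
elim: T => //= L IHL a R IHR; rewrite cat_uniq /= !map_inj_uniq // IHL IHR /=.
rewrite andbT; apply/andP; split; last by apply/mapP => -[].
rewrite negb_or; apply/andP; split; first by apply/mapP => -[].
by apply/hasPn => _ /mapP[x _ ->]; apply/mapP => -[].
Qed.

Lemma spineE b T :
  spine b T = [seq nseq i b | i <- iota 0 (size (spine b T))].
Proof.
suff H S : spine b S = [seq nseq i b | i <- iota 0 (size (spine b S))] ->
    map (cons b) (spine b S) =
    [seq nseq i b | i <- iota 1 (size (spine b S))].
  elim: T => //= L IHL a R IHR; congr cons; rewrite size_map.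
  by case: b IHL IHR H => IHL IHR H; apply: H.
by move=> {1}->; rewrite -map_comp (iotaDl 1 0) -map_comp.
Qed.

Lemma mem_inorder_nseq b T i :
  (nseq i b \in inorder T) = (i < size (spine b T)).
Proof.
rewrite mem_inorder; elim: T i => [|L IHL a R IHR] [|i] //=.
by rewrite size_map ltnS; case: b IHL IHR => IHL IHR; rewrite ?IHL ?IHR.
Qed.

Lemma mem_inorder_cat T u v : u ++ v \in inorder T -> u \in inorder T.
Proof. by rewrite !mem_inorder subtree_cat; case: (subtree T u); case: v. Qed.

Lemma path_top_cat b v : exists i, v = path_top b v ++ nseq i b.
Proof.
elim: v => [|x v [i IHv]]; first by exists 0.
rewrite [path_top _ _]/=; case: ifP => [A|_]; last by exists i; rewrite /= -IHv.
by exists (size (x :: v)); apply/all_pred1P.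
Qed.

Lemma path_top_id b w i :
  (forall u, w != rcons u b) -> path_top b (w ++ nseq i b) = w.
Proof.
elim: w => [|x w IHw] H.
  by case: i => //= i; rewrite all_nseq /= eqxx orbT.
rewrite cat_cons [path_top _ _]/=; case: ifP => [|_].
  rewrite all_cat => /and3P[/eqP xb /all_pred1P wE _].
  by case/eqP: (H (nseq (size w) b)); rewrite {1}wE xb -cats1 -nseqD1r addnC.
by rewrite IHw // => u; apply: contraNneq (H (x :: u)) => ->.
Qed.

Lemma path_top_neq b v u : path_top b v != rcons u b.
Proof.
elim: v u => [|x v IHv] [|y u] //=; case: ifP => //= A; apply/eqP => -[].
  move=> xb E; have [i vE] := path_top_cat b v; move: A.
  by rewrite xb eqxx vE E /= all_nseq /= eqxx orbT.
by move=> _ E; case/eqP: (IHv u).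
Qed.

Lemma dirpathE b T v :
  let w := path_top b v in
  dirpath b T v =
    [seq w ++ nseq i b | i <- iota 0 (size (spine b (subtree T w)))].
Proof. by rewrite /dirpath /= spineE -map_comp size_map size_iota. Qed.

Lemma mem_dirpath b T v : v \in inorder T -> v \in dirpath b T v.
Proof.
have [i vE] := path_top_cat b v; rewrite dirpathE => vT.
apply/mapP; exists i => //; rewrite mem_iota add0n -mem_inorder_nseq.
by rewrite mem_inorder -subtree_cat -vE -mem_inorder.
Qed.

Lemma dirpath_run b (w : position) m :
  path (fun u v => v == rcons u b) w [seq w ++ nseq i b | i <- iota 1 m]
  /\ last w [seq w ++ nseq i b | i <- iota 1 m] = w ++ nseq m b.
Proof.
elim: m => [|m [IHp IHl]]; first by rewrite cats0.
rewrite iota1S map_cat cat_path last_cat IHl IHp /= -cats1 -catA.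
by rewrite -nseqD1r addn1 eqxx.
Qed.

Lemma maximal_dirpath b T v :
  v \in inorder T -> maximal_path b T (dirpath b T v).
Proof.
move=> vT; have := mem_dirpath b vT; rewrite dirpathE.
set w := path_top b v; set n := size _.
have nodeE i : (w ++ nseq i b \in inorder T) = (i < n).
  by rewrite -mem_inorder_nseq !mem_inorder subtree_cat.
have top u : rcons u b != w by rewrite eq_sym path_top_neq.
case: n nodeE => // m nodeE _.
have [Hp Hl] := dirpath_run b w m.
apply/and4P; split.
- apply/allP => _ /mapP[i ltim ->].
  by rewrite mem_iota in ltim; rewrite /= nodeE.
- by rewrite cats0.
- by apply/allP => u _; rewrite cats0.
- by rewrite -/(iota 1 m) cats0 Hl -cats1 -catA -nseqD1r nodeE addn1 ltnn.
Qed.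

Lemma dirpath_unique b T v s :
  maximal_path b T s -> v \in s -> s = dirpath b T v.
Proof.
case: s => [|w s] // /and4P[sT sP /allP top end_s] vs.
have sE : s = [seq w ++ nseq i b | i <- iota 1 (size s)].
  elim/last_ind: s sP {sT end_s vs} => // s x IHs.
  rewrite rcons_path => /andP[/IHs sE /eqP ->].
  have := dirpath_run b w (size s); rewrite -sE => -[_ ->].
  rewrite size_rcons iota1S map_cat -sE /= -!cats1.
  by rewrite -catA -nseqD1r addn1.
have wsE : w :: s = [seq w ++ nseq i b | i <- iota 0 (size s).+1].
  by rewrite /= cats0 -sE.
have wT : w \in inorder T by case/andP: sT.
have Hw u : w != rcons u b.
  apply/eqP => E; have uT : u \in inorder T.
    by apply: (@mem_inorder_cat _ _ [:: b]); rewrite cats1 -E.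
  by have := top u uT; rewrite E eqxx.
have vE : path_top b v = w.
  by move: vs; rewrite wsE => /mapP[i _ ->]; rewrite path_top_id.
rewrite dirpathE vE wsE; congr (map _ (iota 0 _)).
have nodeE i :
  (w ++ nseq i b \in inorder T) = (i < size (spine b (subtree T w))).
  by rewrite -mem_inorder_nseq !mem_inorder subtree_cat.
have [_ lastE] := dirpath_run b w (size s); rewrite -sE in lastE.
apply/eqP; rewrite eqn_leq; apply/andP; split.
  by rewrite -nodeE -lastE; apply: (allP sT); apply: mem_last.
by rewrite leqNgt -nodeE -addn1 nseqD1r catA cats1 -lastE.
Qed.

(* Main.v *)
Require Import Defs.
From mathcomp Require Import all_boot.

(* A decreasing tree is read off from the labels of its right paths, which are
   weakly decreasing, once one knows at which node each right path starts.
   The label i occurs in B_i exactly when its ascent top lies on the diagonal,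
   which fixes the diagonal.  At a node off the diagonal, nub = asctops says
   that there is a left child if and only if the label a is new in the in-order
   traversal, and the right path of this child then carries B_a.  As the left
   subtree of a node only has smaller labels, whether a is new depends only on
   the nodes visited before that subtree, so this rule builds the tree in
   in-order and leaves no choice.  In the tree so built all labels occur: by
   descending induction, i lies in some B_j with j > i or in B_i itself, and
   B_j labels a right path as soon as j occurs. *)

Set Implicit Arguments.
Unset Strict Implicit.
Unset Printing Implicit Defensive.

(** * Labels of a tree and of its left and right spines *)

Lemma labels_Node L a R : labels (Node L a R) = labels L ++ a :: labels R.
Proof. by rewrite /labels /= map_cat /= -!map_comp. Qed.

Lemma mem_labels_le T a : a \in labels T -> a <= max_label T.
Proof.
elim: T => //= L IHL b R IHR; rewrite labels_Node mem_cat in_cons !leq_max.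
by case/or3P => [/IHL -> | /eqP -> | /IHR ->]; rewrite ?leqnn ?orbT.
Qed.

Lemma max_label_leq T n : (max_label T <= n) = all (fun a => a <= n) (labels T).
Proof.
elim: T => //= L IHL b R IHR.
by rewrite labels_Node all_cat /= !geq_max IHL IHR andbCA.
Qed.

Fixpoint right_labels (T : tree) : seq nat :=
  if T is Node _ a R then a :: right_labels R else [::].

Fixpoint left_labels (T : tree) : seq nat :=
  if T is Node L a _ then a :: left_labels L else [::].

Lemma right_labels_eq0 T : (right_labels T == [::]) = ~~ ([::] \in inorder T).
Proof. by rewrite mem_inorder; case: T. Qed.

Lemma right_labelsE T :
  right_labels T = [seq label T v | v <- spine true T].
Proof. by elim: T => //= L _ a R ->; rewrite -map_comp. Qed.

Lemma left_labelsE T : left_labels T = [seq label T v | v <- spine false T].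
Proof. by elim: T => //= L -> a R _; rewrite -map_comp. Qed.

Lemma subtree_root T : subtree T [::] = T.
Proof. by case: T. Qed.

Lemma right_labels_sub T v : {subset right_labels (subtree T v) <= labels T}.
Proof.
elim: T v => [|L IHL a R IHR] [|b v] x //=; rewrite labels_Node mem_cat !in_cons.
  case/orP=> [->|xR]; first by rewrite orbT.
  by rewrite (IHR [::]) ?orbT ?subtree_root.
by case: b => xT; [rewrite (IHR v) | rewrite (IHL v)]; rewrite ?orbT.
Qed.

Lemma right_labels_sorted T : decreasing T -> sorted geq (right_labels T).
Proof.
elim: T => // L _ a [|L' b R] IHR // /and3P[_ /IHR srt].
by rewrite /= in srt *; rewrite srt !geq_max andbT => /andP[_ /andP[]].
Qed.

Lemma left_labels_sorted T :
  strictly_decreasing_left T -> sorted gtn (left_labels T).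
Proof.
elim: T => // [[|L' b R']] IHL a R _ // /and3P[lt_a /IHL srt _].
by rewrite /= in srt *; move: lt_a; rewrite /= !gtn_max srt andbT => /andP[].
Qed.

(** * Labels visited before a given node *)

Definition labels_before (T : tree) (v : position) : seq nat :=
  [seq label T u | u <- take (index v (inorder T)) (inorder T)].

(** The [else] value is the length of the whole traversal, which is what [index] returns on a
    non-member. The right case needs no such test, since a non-member of [inorder R] already yields
    that length. *)
Lemma index_inorder_Node L a R v :
  index v (inorder (Node L a R)) =
    match v with
    | [::] => size (inorder L)
    | false :: u => if u \in inorder L then index u (inorder L)
                    else size (inorder L) + (size (inorder R)).+1
    | true :: u => size (inorder L) + (index u (inorder R)).+1
    end.
Proof.
have inj (b : bool) : injective (cons b) by move=> x y [].
have no (b c : bool) s x : b != c -> (b :: x \in map (cons c) s) = false.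
  by move=> bc; apply/mapP => -[y _ [E _]]; rewrite E eqxx in bc.
rewrite /= index_cat; case: v => [|[] u].
- by rewrite ifF ?size_map /= ?addn0 //; apply/mapP => -[].
- by rewrite no // size_map /= index_map.
- rewrite mem_map // index_map //; case: ifP => //= _.
  by rewrite size_map memNindex ?size_map // no.
Qed.

Lemma labels_before_root L a R : labels_before (Node L a R) [::] = labels L.
Proof.
rewrite /labels_before index_inorder_Node /= take_size_cat ?size_map //.
by rewrite -map_comp.
Qed.

Lemma labels_before_left L a R v : v \in inorder L ->
  labels_before (Node L a R) (false :: v) = labels_before L v.
Proof.
move=> vL; rewrite /labels_before index_inorder_Node vL /=.
by rewrite takel_cat ?size_map ?index_size // -map_take -map_comp.
Qed.

Lemma labels_before_right L a R v :
  labels_before (Node L a R) (true :: v) =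
    labels L ++ a :: labels_before R v.
Proof.
rewrite /labels_before index_inorder_Node /= take_cat size_map ltnNge leq_addr /=.
by rewrite addKn /= map_cat /= -map_take -!map_comp.
Qed.

Lemma forall_inorder_Node (Q : position -> Prop) L a R :
  (forall v, v \in inorder (Node L a R) -> Q v) <->
  [/\ Q [::], forall v, v \in inorder L -> Q (false :: v)
    & forall v, v \in inorder R -> Q (true :: v)].
Proof.
split=> [H | [H0 HL HR] [|b v]] //.
  by split=> [|v vT|v vT]; apply: H; rewrite mem_inorder //= -mem_inorder.
by rewrite mem_inorder /= -mem_inorder; case: b; [apply: HR | apply: HL].
Qed.

(** * The rule for right paths, recursively and node by node *)

Section Attached.

Variable B : nat -> seq nat.

(* [seen] stands for the labels of the nodes preceding [T] in the in-order
   traversal of an ambient tree. *)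
Fixpoint attached (seen : seq nat) (T : tree) : bool :=
  if T is Node L a R then
    [&& right_labels L == (if a \in seen then [::] else B a), attached seen L
      & attached (seen ++ labels L ++ [:: a]) R]
  else true.

(** A diagonal node lies itself on the path labeled by [B a]. Its right subtree is off the diagonal,
    so [attached] takes over there. *)
Fixpoint diag_attached (T : tree) : bool :=
  if T is Node L a R then
    [&& a :: right_labels R == B a, diag_attached L
      & attached (labels L ++ [:: a]) R]
  else true.

Definition attached_at (seen : seq nat) (T : tree) (v : position) : Prop :=
  right_labels (subtree T (lchild v)) =
    if label T v \in seen ++ labels_before T v then [::] else B (label T v).

(** Here [seen] is empty because [T] is the whole tree: [labels_before] already lists all earlier
    labels. *)
Definition diag_attached_at (T : tree) (v : position) : Prop :=
  if v \in spine false T then right_labels (subtree T v) = B (label T v)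
  else attached_at [::] T v.

(** The recursive rule tests the root label against [seen] alone, although the left subtree is also
    visited before the root. Strict decrease to the left makes the two tests agree: the root label
    does not occur in [L]. *)
Lemma attachedP seen T : strictly_decreasing_left T ->
  attached seen T <-> forall v, v \in inorder T -> attached_at seen T v.
Proof.
elim: T seen => [|L IHL a R IHR] seen; first by split.
case/and3P=> lt_a sL sR.
have aL : (a \in labels L) = false.
  by apply: contraTF lt_a => /mem_labels_le; rewrite -leqNgt.
rewrite forall_inorder_Node; split.
- case/and3P=> /eqP E /(IHL _ sL) HL /(IHR _ sR) HR; split=> [|v vL|v vR].
  + by rewrite /attached_at labels_before_root mem_cat aL orbF /label /= subtree_root.
  + by rewrite /attached_at labels_before_left //; apply: HL.
  + by rewrite /attached_at labels_before_right; have := HR v vR; rewrite /attached_at -!catA.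
- case=> E HL HR; apply/and3P; split.
  + move: E; rewrite /attached_at labels_before_root mem_cat aL orbF /label /=.
    by rewrite subtree_root => ->.
  + apply/(IHL _ sL) => v vL; have := HL v vL.
    by rewrite /attached_at labels_before_left.
  + apply/(IHR _ sR) => v vR; have := HR v vR.
    by rewrite /attached_at labels_before_right -!catA.
Qed.

Lemma diag_attachedP T : strictly_decreasing_left T ->
  diag_attached T <-> forall v, v \in inorder T -> diag_attached_at T v.
Proof.
have inj (b : bool) : injective (cons b) by move=> x y [].
have dl L a R v : (false :: v \in spine false (Node L a R)) = (v \in spine false L).
  by rewrite in_cons mem_map.
have dr L a R v : (true :: v \in spine false (Node L a R)) = false.
  by rewrite in_cons /=; apply/mapP => -[].
elim: T => [|L IHL a R _]; first by split.
case/and3P=> lt_a sL sR.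
rewrite forall_inorder_Node; split.
- case/and3P=> /eqP E /(IHL sL) HL /(attachedP _ sR) HR; split=> [|v vL|v vR] //.
  + have := HL v vL; rewrite /diag_attached_at dl; case: ifP => // _.
    by rewrite /attached_at labels_before_left.
  + have := HR v vR; rewrite /diag_attached_at dr /attached_at labels_before_right.
    by rewrite -catA.
- case=> E HL HR; apply/and3P; split; first exact/eqP.
  + apply/(IHL sL) => v vL; have := HL v vL; rewrite /diag_attached_at dl.
    by case: ifP => // _; rewrite /attached_at labels_before_left.
  + apply/(attachedP _ sR) => v vR; have := HR v vR.
    by rewrite /diag_attached_at dr /attached_at labels_before_right -catA.
Qed.

End Attached.

(** * [nub], [asctops] and the diagonal *)

Lemma mem_labels T v : v \in inorder T -> label T v \in labels T.
Proof. exact: map_f. Qed.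

Lemma mem_asctops T v :
  (v \in asctops T) = (v \in inorder T) &&
    ((index v (inorder T) == 0) || (lchild v \in inorder T)).
Proof. by rewrite mem_filter andbC. Qed.

Lemma mem_nub T v :
  (v \in nub T) = (v \in inorder T) && (label T v \notin labels_before T v).
Proof.
rewrite mem_filter andbC; congr (_ && _); rewrite -has_pred1 has_map -all_predC.
exact: eq_all.
Qed.

(** The last node of the left spine is the first one visited; every other one has a left child. *)
Lemma spine_asctops T : {subset spine false T <= asctops T}.
Proof.
elim: T => // L IHL a R _ v; rewrite mem_asctops index_inorder_Node inE.
case/orP=> [/eqP-> | /mapP[u /IHL]].
  by rewrite !mem_inorder; case: L {IHL} => //= *; rewrite orbT.
by rewrite mem_asctops => /andP[uL H] ->; rewrite uL; move: uL H; rewrite !mem_inorder /= => -> ->.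
Qed.

(** Off the diagonal this rules out the exceptional node of [asctops], so that membership there
    means having a left child. *)
Lemma index0_spine T v :
  v \in inorder T -> index v (inorder T) = 0 -> v \in spine false T.
Proof.
elim: T v => // L IHL a R _ [|[] v] vT; rewrite ?index_inorder_Node ?inE //.
  by rewrite addnS.
have vL : v \in inorder L by move: vT; rewrite !mem_inorder.
by rewrite vL => /(IHL _ vL) vs; apply: map_f.
Qed.

(** The nodes visited before a diagonal node all lie in its left subtree, where the labels are
    strictly smaller. *)
Lemma spine_nub T :
  strictly_decreasing_left T -> {subset spine false T <= nub T}.
Proof.
move=> sT v vs; rewrite mem_nub.
have := spine_asctops vs; rewrite mem_asctops => /andP[-> _] /=.
elim: T sT v vs => // L IHL a R _ /and3P[lt_a sL _] [_|b v vs].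
  by rewrite labels_before_root; apply: contraTN lt_a => /mem_labels_le; rewrite -leqNgt.
move: vs; rewrite inE => /mapP[u us [-> ->]].
have := spine_asctops us; rewrite mem_asctops => /andP[uL _].
by rewrite labels_before_left //; apply: IHL.
Qed.

Lemma label_nub_inj T : {in nub T &, injective (label T)}.
Proof.
have le u v : u \in nub T -> v \in nub T -> label T u = label T v ->
    index v (inorder T) <= index u (inorder T).
  rewrite !mem_nub => /andP[uT _] /andP[vT nv] E; rewrite leqNgt.
  apply: contra nv => lt_uv; rewrite -E; apply: map_f.
  by rewrite -[u](nth_index [::] uT) -(nth_take _ lt_uv) mem_nth // size_take index_mem vT.
move=> u v uN vN E; apply: (index_inj [::] (s := inorder T)).
- by rewrite mem_nub in uN; case/andP: uN.
- by rewrite mem_nub in vN; case/andP: vN.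
by apply/eqP; rewrite eqn_leq !le.
Qed.

Lemma nub_label T a :
  a \in labels T -> exists2 v, v \in nub T & label T v = a.
Proof.
move=> aT; set i := index a (labels T).
have lt_i : i < size (inorder T) by rewrite -(size_map (label T)) index_mem.
have lE : label T (nth [::] (inorder T) i) = a.
  by rewrite -(nth_map _ 0) // nth_index.
exists (nth [::] (inorder T) i) => //.
rewrite mem_nub mem_nth //= lE /labels_before index_uniq ?uniq_inorder //.
by rewrite map_take -/(labels T) in_take // ltnn.
Qed.

(** * Labels along the paths defining the blocks *)

(** The list whose multiset is [block T i], kept in the order of the path. *)
Definition path_labels (T : tree) (i : nat) : seq nat :=
  [seq label T v | v <- wpath T i].

Lemma label_subtree T w v : label T (w ++ v) = label (subtree T w) v.
Proof. by rewrite /label subtree_cat. Qed.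

Lemma rpath_labels T v : (forall u, v != rchild u) ->
  [seq label T u | u <- rpath T v] = right_labels (subtree T v).
Proof.
move=> Hv; rewrite right_labelsE /rpath /dirpath.
have -> : path_top true v = v by rewrite -{1}[v]cats0 (path_top_id 0).
by rewrite -map_comp; apply: eq_map => u /=; apply: label_subtree.
Qed.

Lemma diagE T : diag T = spine false T.
Proof. by rewrite /diag /lpath /dirpath /= subtree_root map_id. Qed.

(** Labels are injective on [nub], hence on [asctops], so [asctop_of] can only return [v]. Neither a
    diagonal node nor a left child is a right child, so the path starts at the node in question. *)
Lemma path_labels_asctop T v : nub T =i asctops T -> v \in asctops T ->
  path_labels T (label T v) =
    right_labels (subtree T (if v \in spine false T then v else lchild v)).
Proof.
move=> nubE vA; rewrite /path_labels /wpath.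
have -> : asctop_of T (label T v) = v.
  rewrite /asctop_of; set s := filter _ _.
  have : v \in s by rewrite mem_filter eqxx.
  have : {subset s <= [pred u | (u \in nub T) && (label T u == label T v)]}.
    move=> u; rewrite mem_filter => /andP[E uA].
    by rewrite inE (nubE u) uA.
  case: s => //= u s /(_ u (mem_head _ _)) /andP[uN /eqP E] _.
  by apply: label_nub_inj uN _ E; rewrite nubE.
rewrite diagE; case: ifP => [vs|_]; apply: rpath_labels => u; last first.
  by apply/eqP => /rcons_inj[].
(* The address of a diagonal node consists of [false] only, so it cannot end in [true]. *)
rewrite spineE in vs; case/mapP: vs => i _ ->.
apply/eqP => /(congr1 (fun s => true \in s)).
by rewrite mem_rcons mem_head mem_nseq andbF.
Qed.

(** Diagonal nodes belong to both [nub] and [asctops]. Elsewhere, being in [asctops] means that the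
    right path of the left child is nonempty; as [B a] is nonempty, the rule makes this equivalent
    to the label being new. *)
Lemma diag_attached_nub B T : strictly_decreasing_left T ->
    (forall a, a \in labels T -> B a <> [::]) ->
  diag_attached B T <->
  nub T =i asctops T /\ forall a, a \in labels T -> path_labels T a = B a.
Proof.
move=> sT nB.
have lchildE v : (lchild v \in inorder T) = (right_labels (subtree T (lchild v)) != [::]).
  by rewrite right_labels_eq0 negbK !mem_inorder subtree_root.
have nspine v : v \in inorder T -> v \notin spine false T ->
    (v \in asctops T) = (lchild v \in inorder T).
  move=> vT nvs; rewrite mem_asctops vT /=.
  by case: eqP => // /(index0_spine vT) vs; rewrite vs in nvs.
split=> [/(diag_attachedP _ sT) H | [nubE H]].
  have nubE : nub T =i asctops T.
    move=> v; have [vT|nvT] := boolP (v \in inorder T); last first.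
      by rewrite mem_nub mem_asctops (negPf nvT).
    have [vs|nvs] := boolP (v \in spine false T).
      by rewrite (spine_nub sT vs) (spine_asctops vs).
    rewrite nspine // lchildE mem_nub vT.
    have := H v vT; rewrite /diag_attached_at (negPf nvs) => ->.
    by case: ifP => //= _; apply/esym/eqP/nB/mem_labels.
  split=> // a /nub_label[v vN <-].
  have vA : v \in asctops T by rewrite -nubE.
  rewrite path_labels_asctop //; move: vN; rewrite mem_nub => /andP[vT nv].
  have := H v vT; rewrite /diag_attached_at /attached_at /= (negPf nv).
  by case: ifP.
apply/(diag_attachedP _ sT) => v vT; rewrite /diag_attached_at /attached_at /=.
case: ifP => [vs|nvs].
  by rewrite -H ?mem_labels // path_labels_asctop ?vs //; apply: spine_asctops.
(* A repeated label puts [v] outside [nub], hence outside [asctops], so there is no left child. *)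
case: ifP => nv.
  apply/eqP; rewrite -[_ == _]negbK -lchildE -nspine ?nvs // -nubE mem_nub.
  by rewrite nv andbF.
have vA : v \in asctops T by rewrite -nubE mem_nub vT nv.
by rewrite -H ?mem_labels // path_labels_asctop // nvs.
Qed.

Lemma geq_trans : transitive geq.
Proof. by move=> x y z /= yx xz; apply: leq_trans xz yx. Qed.

Lemma geq_total : total geq.
Proof. by move=> x y; apply: leq_total. Qed.

Lemma decreasing_subtree T v : decreasing T -> decreasing (subtree T v).
Proof.
elim: T v => [|L IHL a R IHR] [|b v] // /and3P[dL dR _].
by case: b; [apply: IHR | apply: IHL].
Qed.

Lemma right_labels_lchild_lt T v x : strictly_decreasing_left T ->
  x \in right_labels (subtree T (lchild v)) -> x < label T v.
Proof.
elim: T v => [|L IHL a R IHR] [|b v] // /and3P[lt_a sL sR].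
  by move=> /(@right_labels_sub L [::])/mem_labels_le xL; apply: leq_ltn_trans lt_a.
by case: b; [apply: IHR | apply: IHL].
Qed.

Lemma path_labels_right T a : nub T =i asctops T -> a \in labels T ->
  exists v, path_labels T a = right_labels (subtree T v).
Proof.
move=> nubE /nub_label[v vN <-].
by rewrite path_labels_asctop -?nubE //; eexists.
Qed.

(** * Uniqueness of the tree with prescribed path labels *)

Section Cover.

Variable B : nat -> seq nat.

(** The right labels give the root label, and the rule then gives the right labels of the left
    subtree. Once the left subtrees agree, both right subtrees obey the rule for the same [seen]. *)
Lemma attached_inj seen T T' : attached B seen T -> attached B seen T' ->
  right_labels T = right_labels T' -> T = T'.
Proof.
elim: T seen T' => [|L IHL a R IHR] seen [|L' b R'] //=.
move=> /and3P[/eqP EL aL aR] /and3P[/eqP EL' aL' aR'] [ab ER].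
subst b.
have LL' : L = L' by apply: IHL aL aL' _; rewrite EL EL'.
by subst L'; congr Node; apply: IHR aR aR' ER.
Qed.

Lemma diag_attached_inj T T' : diag_attached B T -> diag_attached B T' ->
  left_labels T = left_labels T' -> T = T'.
Proof.
elim: T T' => [|L IHL a R _] [|L' b R'] //=.
move=> /and3P[/eqP ER dL aR] /and3P[/eqP ER' dL' aR'] [ab EL].
subst b.
have LL' : L = L' by apply: IHL.
subst L'; congr Node; apply: attached_inj aR aR' _.
by move: ER; rewrite -ER' => -[].
Qed.

(** A diagonal node with label [a] lies on the path labeled by [B a]. Off the diagonal that path
    starts at a left child, so all its labels are less than [a]. *)
Lemma mem_left_labels T a : strictly_decreasing_left T -> diag_attached B T ->
  (a \in left_labels T) = (a \in labels T) && (a \in B a).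
Proof.
move=> sT /(diag_attachedP _ sT) H; rewrite left_labelsE.
apply/mapP/andP => [[v vs ->]|[/nub_label[v]]].
  have := spine_nub sT vs; rewrite mem_nub => /andP[vT _].
  rewrite mem_labels //; have := H v vT; rewrite /diag_attached_at vs => <-.
  by move: vT; rewrite mem_inorder /label; case: (subtree T v) => //= *; rewrite mem_head.
rewrite mem_nub => /andP[vT nv] <- aB; exists v => //.
have := H v vT; rewrite /diag_attached_at /attached_at /= (negPf nv).
case: ifP => // _ E; move: aB; rewrite -E => /(right_labels_lchild_lt sT).
by rewrite ltnn.
Qed.

Lemma diag_attached_unique T T' :
    strictly_decreasing_left T -> strictly_decreasing_left T' ->
    labels T =i labels T' ->
  diag_attached B T -> diag_attached B T' -> T = T'.
Proof.
move=> sT sT' lE dT dT'; apply: diag_attached_inj => //.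
(* The diagonal labels decrease strictly, so their set determines the list. *)
apply: (irr_sorted_eq (leT := gtn)) (left_labels_sorted sT) (left_labels_sorted sT') _.
- by move=> a b c /= ba cb; apply: ltn_trans cb ba.
- by move=> a /=; rewrite ltnn.
- by move=> a; rewrite !mem_left_labels // lE.
Qed.

(** * Existence of the tree with prescribed path labels *)

Variable k : nat.
Hypothesis B_neq0 : forall i, 0 < i <= k -> B i <> [::].
Hypothesis B_sorted : forall i, sorted geq (B i).
Hypothesis B_le : forall i j, 0 < i <= k -> j \in B i -> 0 < j <= i.
Hypothesis B_onto : forall a, 0 < a <= k -> exists2 i, 0 < i <= k & a \in B i.

(** Induction on the label bound [n], then on the list [s] prescribed for the right path. The last
    hypothesis ensures that a new label [a] is not in [B a]; all entries of [B a] are then below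
    [a], so the left subtree comes from a smaller bound and is strictly smaller in labels. *)
Lemma exists_attached n s seen : n <= k -> sorted geq s ->
    (forall a, a \in s -> 0 < a <= n) ->
    (forall i, 0 < i <= n -> i \in B i -> i \in seen) ->
  exists T, [/\ right_labels T = s, decreasing T && strictly_decreasing_left T,
    attached B seen T, 0 \notin labels T & max_label T <= head 0 s].
Proof.
have nil seen' : exists T, [/\ right_labels T = [::],
    decreasing T && strictly_decreasing_left T, attached B seen' T,
    0 \notin labels T & max_label T <= 0] by exists Empty.
elim: n s seen => [|n IHn] s seen.
  case: s => [|a s] _ _ H _; first exact: nil.
  by case/andP: (H a (mem_head _ _)) => a0; rewrite leqNgt a0.
move=> ltn; elim: s seen => [|a s IHs] seen srt sn Hs; first exact: nil.
have a_n : 0 < a <= n.+1 by apply: sn; apply: mem_head.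
have /andP[a_gt0 le_a] := a_n.
have a_k : 0 < a <= k by rewrite a_gt0 (leq_trans le_a).
have [L [EL sL aL zL mL]] : exists L,
    [/\ right_labels L = (if a \in seen then [::] else B a),
      decreasing L && strictly_decreasing_left L, attached B seen L,
      0 \notin labels L & max_label L < a].
  case: ifP => a_seen; first by exists Empty.
  have Bn j : j \in B a -> 0 < j < a.
    move=> jB; have /andP[-> le_j] := B_le a_k jB; rewrite ltn_neqAle le_j andbT.
    by apply: contraFneq a_seen => ja; apply: Hs => //; rewrite -{1}ja.
  have [|j /Bn/andP[-> lt_j]|i /andP[i0 le_i]|L [EL sL aL zL mL]] :=
      IHn (B a) seen _ (B_sorted a).
  - exact: ltnW.
  - by rewrite -ltnS (leq_trans lt_j).
  - by apply: Hs; rewrite i0 leqW.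
  exists L; split => //; apply: leq_ltn_trans mL _.
  (* An empty list gives the default head [0], still below [a]. *)
  by case: (B a) Bn => //= b t Bn; case/andP: (Bn b (mem_head _ _)).
have [||i i_n iB|R [ER sR aR zR mR]] := IHs (seen ++ labels L ++ [:: a]).
- exact: path_sorted srt.
- by move=> b bs; apply: sn; rewrite inE bs orbT.
- by rewrite mem_cat Hs.
exists (Node L a R).
move: sL sR => /andP[dL sL] /andP[dR sR].
have le_R : max_label R <= a.
  by apply: leq_trans mR _; case: (s) srt => //= b t /andP[].
split=> /=.
- by rewrite ER.
- by rewrite dL sL dR sR mL geq_max le_R ltnW.
- by rewrite EL eqxx aL aR.
- by rewrite labels_Node mem_cat inE !negb_or zL zR eq_sym -lt0n a_gt0.
- by rewrite !geq_max leqnn le_R ltnW.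
Qed.

(** The diagonal grows from its bottom: [m.+1] becomes a new root above the previous tree exactly
    when it lies in its own block. The last conjunct supplies the condition on [seen] that
    [exists_attached] requires for the next right subtree. *)
Lemma exists_diag_attached m : m <= k ->
  exists T, [/\ decreasing T && strictly_decreasing_left T, diag_attached B T,
    0 \notin labels T, max_label T <= m
    & forall i, 0 < i <= m -> i \in B i -> i \in labels T].
Proof.
elim: m => [|m IHm] lt_m.
  by exists Empty; split=> // i /andP[i0]; rewrite leqNgt i0.
have [T [/andP[dT sT] aT zT mT HT]] := IHm (ltnW lt_m).
have [mB|nmB] := boolP (m.+1 \in B m.+1); last first.
  exists T; split=> //; rewrite ?dT // ?leqW // => i /andP[i0].
  rewrite leq_eqVlt => /predU1P[-> mB|]; first by rewrite mB in nmB.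
  by rewrite ltnS => le_i; apply: HT; rewrite i0.
(* The block is weakly decreasing, bounded by [m.+1] and contains it, so it starts with it; the tail
   [s] is left for the right subtree. *)
have [s Bs] : exists s, B m.+1 = m.+1 :: s.
  case: (B m.+1) (B_sorted m.+1) (@B_le m.+1) mB => // b s srt le mB.
  exists s; congr cons; apply/eqP; rewrite eqn_leq.
  case/andP: (le b lt_m (mem_head _ _)) => _ -> /=.
  move: mB; rewrite inE => /predU1P[-> //|ms].
  have /allP : all (geq b) s.
    exact: order_path_min geq_trans srt.
  exact.
have [||i|R [ER /andP[dR sR] aR zR mR]] :=
    @exists_attached m.+1 s (labels T ++ [:: m.+1]) lt_m.
- by have := B_sorted m.+1; rewrite Bs => /path_sorted.
- by move=> a as_; apply: B_le => //; rewrite Bs inE as_ orbT.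
- move=> /andP[i0]; rewrite mem_cat inE orbC leq_eqVlt; case: eqP => //= _.
  by rewrite ltnS => le_i; apply: HT; rewrite i0.
have le_R : max_label R <= m.+1.
  apply: leq_trans mR _.
  by have := B_sorted m.+1; rewrite Bs; case: (s) => //= b t /andP[].
exists (Node T m.+1 R); split=> /=.
- by rewrite dT sT dR sR geq_max le_R ltnS mT leqW.
- by rewrite ER Bs eqxx aT aR.
- by rewrite labels_Node mem_cat inE !negb_or zT zR.
- by rewrite !geq_max leqnn le_R leqW.
move=> i /andP[i0]; rewrite labels_Node mem_cat inE orbCA leq_eqVlt.
by case: eqP => //= _; rewrite ltnS => le_i iB; rewrite HT ?i0.
Qed.

Lemma exists_onto_diag_attached :
  exists T, [/\ decreasing T, strictly_decreasing_left T, diag_attached B T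
    & forall a, (a \in labels T) = (0 < a <= k)].
Proof.
have [T [/andP[dT sT] aT zT mT HT]] := exists_diag_attached (leqnn k).
have T_k a : a \in labels T -> 0 < a <= k.
  move=> aL; rewrite (leq_trans (mem_labels_le aL)) // andbT lt0n.
  by apply: contraNneq zT => <-.
have [nubE pE] : nub T =i asctops T /\ forall a, a \in labels T -> path_labels T a = B a.
  by apply/diag_attached_nub => // a /T_k/B_neq0.
exists T; split=> // a; apply/idP/idP => [/T_k //|].
(* Descending induction on [a], through the measure [k - a]. *)
have [n le_n] := ubnP (k - a); elim: n a le_n => // n IHn a lt_n a_k.
have [i i_k aB] := B_onto a_k.
have /andP[_] := B_le i_k aB; rewrite leq_eqVlt => /predU1P[ai|lt_ai].
  by rewrite -ai in aB; apply: HT.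
have iT : i \in labels T.
  apply: IHn => //; have lt_k : a < k.
    by case/andP: i_k => _; apply: leq_trans lt_ai.
  by apply: leq_trans (ltn_sub2l lt_k lt_ai) _; rewrite -ltnS.
have [v E] := path_labels_right nubE iT.
by apply: (@right_labels_sub _ v); rewrite -E pE.
Qed.

End Cover.

(** * From sorted lists back to multisets and Fishburn covers *)

(** Weakly decreasing order is the order in which a right path of a decreasing tree meets its
    labels. *)
Definition sorted_block (P : seq {mset nat}%mset) (i : nat) : seq nat :=
  sort geq (nth mset0 P i.-1).

(** A multiset has only one weakly decreasing enumeration, so passing from path labels to blocks
    loses nothing. *)
Lemma seq_mset_sorted (s : seq nat) (A : {mset nat}%mset) :
  sorted geq s -> seq_mset s = A <-> s = sort geq A.
Proof.
move=> srt; split=> [<- | ->].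
  apply: (sorted_eq geq_trans) => //.
  - by move=> x y /andP[xy yx]; apply/anti_leq/andP.
  - exact: sort_sorted geq_total _.
  - by rewrite perm_sym perm_sort perm_eq_seq_mset.
rewrite -[RHS]seq_mset_id; apply/eq_seq_msetP; exact/permPl/perm_sort.
Qed.

Lemma sorted_block_neq0 P a :
  fishburn_cover P -> 0 < a <= size P -> sorted_block P a <> [::].
Proof.
case: a => // a [P0 _ _] /= lt_a /(congr1 size); rewrite size_sort => /size0nil E.
have /negP[] := P0 _ (mem_nth mset0 lt_a).
rewrite -[nth _ _ _]seq_mset_id E.
by apply/eqP/msetP => x; rewrite mset_seqE mset0E.
Qed.

Lemma fishburn_coverP P T : fishburn_cover P ->
  fishburn_tree T /\ cover_of T = P <->
  [/\ decreasing T, strictly_decreasing_left T,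
      diag_attached (sorted_block P) T
    & forall a, (a \in labels T) = (0 < a <= size P)].
Proof.
move=> hP.
have nB a := @sorted_block_neq0 P a hP.
have max_labelE k : (forall a, (a \in labels T) = (0 < a <= k)) -> max_label T = k.
  move=> lE; apply/eqP; rewrite eqn_leq max_label_leq; apply/andP; split.
    by apply/allP => a; rewrite lE => /andP[].
  by case: k lE => // k lE; apply: mem_labels_le; rewrite lE leqnn.
have blockE a : decreasing T -> nub T =i asctops T -> a \in labels T ->
    block T a = nth mset0 P a.-1 <-> path_labels T a = sorted_block P a.
  move=> dT nubE /(path_labels_right nubE)[v E].
  apply: seq_mset_sorted; rewrite -/(path_labels T a) E.
  exact/right_labels_sorted/decreasing_subtree.
split.
  case=> -[[/and3P[dT sT _] [k _ lE]] nubE] PE.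
  have kE : k = size P by rewrite -PE size_map size_iota (max_labelE k).
  rewrite {k}kE in lE; split=> //; apply/diag_attached_nub => // [a|].
    by rewrite lE => /nB.
  split=> // a aT; apply/blockE => //; move: aT; rewrite lE -{2}PE.
  rewrite -(max_labelE _ lE) => /andP[a0 le_a].
  have lt_a : a.-1 < max_label T by rewrite prednK.
  by rewrite (nth_map 0) ?size_iota // nth_iota // add1n prednK.
move=> [dT sT aT lE].
have [nubE pE] : nub T =i asctops T /\
    forall a, a \in labels T -> path_labels T a = sorted_block P a.
  by apply/diag_attached_nub => // a; rewrite lE => /nB.
have mE := max_labelE _ lE.
(* The distinct labels [1], ..., [size P] all occur, so there are at least that many nodes; this
   bounds the labels as an endotree requires. *)
have le_P : size P <= tree_size T.
  rewrite /tree_size -(size_map (label T)) -[X in X <= _](size_iota 1).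
  by apply: uniq_leq_size (iota_uniq _ _) _ => a; rewrite mem_iota add1n ltnS lE.
split.
  split=> //; split; last by exists (size P).
  rewrite /endotree dT sT; apply/allP => a; rewrite lE => /andP[-> le_a].
  exact: leq_trans le_P.
apply: (@eq_from_nth _ mset0); rewrite size_map size_iota mE // => i lt_i.
rewrite /cover_of mE (nth_map 0) ?size_iota // nth_iota // add1n.
have iT : i.+1 \in labels T by rewrite lE.
by apply: (proj2 (blockE i.+1 dT nubE iT)); apply: pE.
Qed.

Theorem theorem3p9 (P : seq {mset nat}%mset) (hP : fishburn_cover P) :
  exists! T : tree, fishburn_tree T /\ cover_of T = P.
Proof.
have [_ Pk Pi] := hP.
have mem_block a i : (a \in sorted_block P i) = (a \in nth mset0 P i.-1).
  exact: mem_sort.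
have [a|i|i j i_k|a|T [dT sT aT lE]] :=
    @exists_onto_diag_attached (sorted_block P) (size P).
- exact: sorted_block_neq0.
- exact: sort_sorted geq_total _.
- rewrite mem_block => jB; rewrite (Pi i) // andbT.
  (* Positivity comes from the second condition on covers: [j] occurs in some block. *)
  suff /andP[] : 0 < j <= size P by [].
  by apply/Pk; exists (nth mset0 P i.-1) => //; rewrite mem_nth // prednK; case/andP: i_k.
- case/Pk=> A AP aA; exists (index A P).+1; first by rewrite /= index_mem.
  by rewrite mem_block /= nth_index.
exists T; split; first exact/(fishburn_coverP _ hP).
move=> T' /(fishburn_coverP _ hP)[dT' sT' aT' lE'].
by apply: diag_attached_unique aT aT' => // a; rewrite lE lE'.
Qed.
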